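(* Let $X$ be a Banach space and let $p$ be a positive integer. There exist reals $c_2^p,c_3^p,\dots,c_{2p+1}^p$, depending only on $p$, such that the following holds. Let $[a,b]$, $a<b$, be a real interval, $u\in C^{2p+3}([a,b],X)$, and let $a=\tau_0<\tau_1<\dots<\tau_{2p+1}=b$ be the uniform partition of $[a,b]$, that is $\tau_n=a+nk$ with $k=(b-a)/(2p+1)$, and $\tau_{p+1/2}=(a+b)/2$. Then $$u'(\tau_{p+1/2})=\frac{u(b)-u(a)}{b-a}-\frac{1}{b-a}\sum_{i=1}^pc^p_{2i+1}k^{2i+1}D(D_+D_-)^iu(\tau_{p+1/2})+O(k^{2p+2})$$ and $$u(\tau_{p+1/2})=\frac{u(b)+u(a)}{2}-\sum_{i=1}^pc^p_{2i}k^{2i}(D_+D_-)^iEu(\tau_{p+1/2})+O(k^{2p+2}).$$ The coefficients for $p=1,2,3,4$ are: $p=1$: $c_2^1=\frac98$, $c_3^1=\frac98$. $p=2$: $c_2^2=\frac{25}{8}$, $c_3^2=\frac{125}{24}$, $c_4^2=\frac{125}{128}$, $c_5^2=\frac{125}{128}$. $p=3$: $c_2^3=\frac{49}{8}$, $c_3^3=\frac{343}{24}$, $c_4^3=\frac{637}{128}$, $c_5^3=\frac{13377}{1920}$, $c_6^3=\frac{1029}{1024}$, $c_7^3=\frac{1029}{1024}$. $p=4$: $c_2^4=\frac{81}{8}$, $c_3^4=\frac{243}{8}$, $c_4^4=\frac{1917}{128}$, $c_5^4=\frac{17253}{640}$, $c_6^4=\frac{7173}{1024}$, $c_7^4=\frac{64557}{7168}$,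 $c_8^4=\frac{32733}{32768}$, $c_9^4=\frac{32733}{32768}$.
   Context: The difference operators are those with spacing $k$ on the nodes $\tau_n=a+nk$: $D_+v(\tau_n)=\frac{v(\tau_{n+1})-v(\tau_n)}{k}$, $D_-v(\tau_n)=\frac{v(\tau_n)-v(\tau_{n-1})}{k}$, $Dv(\tau_{n+1/2})=\frac{v(\tau_{n+1})-v(\tau_n)}{k}$, $Ev(\tau_{n+1/2})=\frac{v(\tau_{n+1})+v(\tau_n)}{2}$; composites are defined recursively, and $D(D_+D_-)^iu(\tau_{p+1/2})$ and $(D_+D_-)^iEu(\tau_{p+1/2})$ mean $D$, respectively $E$, applied to $v=(D_+D_-)^iu$. In $c_i^p$ the superscript $p$ is an index, not a power. The constants implied in $O(k^{2p+2})$ depend only on $p$ and on bounds for the norms of the derivatives of $u$ up to order $2p+3$ on $[a,b]$ (not otherwise on $k$, $a$, $b$). *)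

(* Defs.v *)
From HB Require Import structures.
From mathcomp Require Import all_boot all_order all_algebra.
From mathcomp Require Import all_classical all_reals all_analysis.

Set Implicit Arguments.
Unset Strict Implicit.
Unset Printing Implicit Defensive.

Import Order.TTheory GRing.Theory Num.Theory.
Import numFieldNormedType.Exports.

Local Open Scope classical_set_scope.
Local Open Scope ring_scope.

Section Differentiability.
Variables (R : realType) (X : normedModType R).
Implicit Types (A : set R) (f : R -> X) (x : R).

Definition diff_quot f x : R -> X := fun y => (y - x)^-1 *: (f y - f x).

(* The limit is taken along y in A, y != x: for A = `[a, b] the derivative is
   one-sided at the endpoints and f is not looked at outside [a, b]. *)
Definition derivable_within A f x : Prop :=
  cvg (diff_quot f x @ within A x^').

Definition derive_within A f : R -> X :=
  fun x => lim (diff_quot f x @ within A x^').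

Definition derive_within_n A (j : nat) f : R -> X := iter j (derive_within A) f.

(* f : R -> X restricts to an element of C^m([a, b], X). *)
Definition Cm_on (m : nat) (a b : R) f : Prop :=
  (forall j : nat, (j < m)%N -> forall x : R, x \in `[a, b] ->
     derivable_within `[a, b] (derive_within_n `[a, b] j f) x) /\
  {within `[a, b], continuous (derive_within_n `[a, b] m f)}.

End Differentiability.

(* A grid function v is indexed by int: v n is its value at the node
   tau_n = a + n k.  Dhalf k v n and Ehalf v n are the values at
   tau_(n + 1/2). *)
Section DifferenceOperators.
Variables (R : realType) (X : normedModType R) (k : R).
Implicit Type v : int -> X.

Definition Dplus v : int -> X := fun n => k^-1 *: (v (n + 1) - v n).
Definition Dminus v : int -> X := fun n => k^-1 *: (v n - v (n - 1)).
Definition DplusDminus (i : nat) v : int -> X := iter i (Dplus \o Dminus) v.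
Definition Dhalf v : int -> X := fun n => k^-1 *: (v (n + 1) - v n).
Definition Ehalf v : int -> X := fun n => 2^-1 *: (v (n + 1) + v n).

End DifferenceOperators.

(* Values at the nodes tau_n = a + n k.  For n outside the partition they
   depend on the arbitrary extension of u to R, but the operators evaluated
   at tau_(p + 1/2) up to the power i = p only use tau_0, ..., tau_(2p+1). *)
Definition grid (R : realType) (X : normedModType R) (a k : R) (u : R -> X) :
  int -> X := fun n => u (a + n%:~R * k).

(* Main.v *)
(** With N = 2p+1 and phi(s) = u((a+b)/2 + s k), both formulas are Bessel's
    central interpolation formula truncated at order p.  Put
      G_i(x) = \prod_(j < i) (x^2 - (j + 1/2)^2),
      f_i = G_i / (2i)!,   e_i = x G_i / (2i+1)!.
    The second difference maps f_(i+1) to f_i and e_(i+1) to e_i, and kills f_0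
    and e_0, while f_i(1/2) = f_i(-1/2) = [i = 0] and e_i(1/2) = 1/2 [i = 0].
    Hence an even polynomial f of degree <= 2p is the sum of the
    (mu delta^(2i) f)(0) f_i, and an odd one of degree <= 2p+1 the sum of the
    (delta^(2i+1) f)(0) e_i; comparing the values at N/2 with the value, resp.
    the derivative, at 0 gives
      c_(2i) = f_i(N/2) - f_i(0),   c_(2i+1) = 2 e_i(N/2) - N e_i'(0).
    The two error functionals thus vanish on polynomials of degree <= 2p+1,
    resp. <= 2p+2, and the estimates follow from Taylor's formula at the
    midpoint. *)

Require Import Defs.
From HB Require Import structures.
From mathcomp Require Import all_boot all_order all_algebra ring lra zify.
From mathcomp Require Import all_classical all_reals all_analysis.
Import Order.TTheory GRing.Theory Num.Theory.
Import numFieldNormedType.Exports.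
Local Open Scope classical_set_scope.
Local Open Scope ring_scope.

Set Implicit Arguments.
Unset Strict Implicit.
Unset Printing Implicit Defensive.

(** * Bessel's interpolation basis *)

Section SecondDifference.
Variables (A : pzRingType) (V : zmodType).
Implicit Types (f g : A -> V) (i : nat).

(** The domain is any ring because the same operator acts on grid functions over [int] and on
    functions of the rescaled real variable. *)
Definition second_diff f : A -> V := fun x => f (x + 1) - f x *+ 2 + f (x - 1).

Lemma second_diffE f x : second_diff f x = f (x + 1) - f x *+ 2 + f (x - 1).
Proof. by []. Qed.

Lemma iter_second_diffD i f g :
  iter i second_diff (fun x => f x + g x)
  = (fun x => iter i second_diff f x + iter i second_diff g x).
Proof.
elim: i => //= i ->; apply/funext => x; rewrite !second_diffE mulrnDl opprD.
by rewrite (addrACA (iter i _ f (x + 1))) [LHS]addrACA.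
Qed.

Lemma iter_second_diff_even i f :
  (forall x, f (- x) = f x) ->
  forall x, iter i second_diff f (- x) = iter i second_diff f x.
Proof.
move=> f_even; elim: i => //= i IH x; rewrite !second_diffE IH.
have -> : - x + 1 = - (x - 1) by rewrite opprB addrC.
by rewrite -opprD !IH [LHS]addrC [LHS]addrCA [LHS]addrC.
Qed.

Lemma iter_second_diff_odd i f :
  (forall x, f (- x) = - f x) ->
  forall x, iter i second_diff f (- x) = - iter i second_diff f x.
Proof.
move=> f_odd; elim: i => //= i IH x; rewrite !second_diffE IH.
have -> : - x + 1 = - (x - 1) by rewrite opprB addrC.
rewrite -opprD !IH mulNrn -!opprD; congr (- _).
by rewrite [LHS]addrC [LHS]addrCA [LHS]addrC.
Qed.

End SecondDifference.

Lemma iter_second_diffZ (F : numFieldType) (V : lmodType F) i (f : F -> F)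
    (w : V) :
  iter i (@second_diff F V) (fun x => f x *: w)
  = (fun x => iter i (@second_diff F F) f x *: w).
Proof.
elim: i => //= i ->; apply/funext => x.
by rewrite !second_diffE scalerDl scalerBl scalerMnl.
Qed.

Section BesselBasis.
Variable F : numFieldType.
Implicit Types (x : F) (i q : nat).

Definition node_prod i x : F := \prod_(j < i) (x ^+ 2 - (j%:R + 2^-1) ^+ 2).

Lemma node_prodS i x :
  node_prod i.+1 x = node_prod i x * (x ^+ 2 - (i%:R + 2^-1) ^+ 2).
Proof. by rewrite /node_prod big_ord_recr. Qed.

(** The roots of $G_{i+1}(x+1)$ are the half-integers from $-(i+3/2)$ to $i-1/2$: those of $G_i$ and
    two more on the left. *)
Lemma node_prod_addr1 i x :
  node_prod i.+1 (x + 1)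
  = node_prod i x * (x + i%:R + 2^-1) * (x + i%:R + 3 / 2).
Proof.
elim: i => [|i IH]; first by rewrite node_prodS /node_prod !big_ord0; field.
by rewrite node_prodS IH node_prodS -natr1; field.
Qed.

Lemma node_prodN i x : node_prod i (- x) = node_prod i x.
Proof. by apply: eq_bigr => j _; rewrite sqrrN. Qed.

Lemma node_prod_subr1 i x :
  node_prod i.+1 (x - 1)
  = node_prod i x * (x - i%:R - 2^-1) * (x - i%:R - 3 / 2).
Proof.
by rewrite -node_prodN opprB addrC node_prod_addr1 node_prodN; field.
Qed.

Definition bessel_even i x : F := node_prod i x / (2 * i)`!%:R.
Definition bessel_odd i x : F := x * node_prod i x / (2 * i + 1)`!%:R.

(** The three values share the factor $G_i$, and their cofactors combine to the constant
    $(2i+1)(2i+2)$, the quotient of the two factorials. *)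
Lemma second_diff_bessel_even i :
  second_diff (bessel_even i.+1) = bessel_even i.
Proof.
apply/funext => x; rewrite second_diffE /bessel_even.
rewrite node_prod_addr1 node_prod_subr1 node_prodS mulnS !factS !natrM.
rewrite -!natr1 natrM.
field; rewrite -natrM !natr1 !pnatr_eq0 -lt0n fact_gt0 /=.
by [].
Qed.

Lemma second_diff_bessel_odd i :
  second_diff (bessel_odd i.+1) = bessel_odd i.
Proof.
apply/funext => x; rewrite second_diffE /bessel_odd.
rewrite node_prod_addr1 node_prod_subr1 node_prodS mulnS -addnA addn1.
rewrite !factS !natrM.
rewrite -!natr1 natrM.
field; rewrite -natrM !natr1 !pnatr_eq0 -lt0n fact_gt0 /=.
by [].
Qed.
End BesselBasis.

Section BesselBasisTheory.
Variable F : numFieldType.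
Implicit Types (x : F) (i q : nat).

Lemma node_prod_half i x : x ^+ 2 = 2^-1 ^+ 2 -> node_prod i x = (i == 0)%:R.
Proof.
move=> x2; case: i => [|i]; first by rewrite /node_prod big_ord0.
by rewrite /node_prod big_ord_recl x2 add0r subrr mul0r.
Qed.

Lemma iter_second_diff0 (V : zmodType) i :
  iter i (@second_diff F V) (fun=> 0) = (fun=> 0).
Proof.
elim: i => //= i ->; apply/funext => x.
by rewrite second_diffE mul0rn subr0 addr0.
Qed.

(** Each second difference lowers the index by one. For $i<q$ the result $f_{q-i}$ vanishes at $\pm
    1/2$; for $i>q$ the constant $f_0$ is reached and then killed. *)
Lemma iter_second_diff_bessel_even i q x : x ^+ 2 = 2^-1 ^+ 2 ->
  iter i (@second_diff F F) (@bessel_even F q) x = (i == q)%:R.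
Proof.
move=> x2; elim: q i => [|q IH] [|i].
- by rewrite /bessel_even /= node_prod_half // muln0 fact0 divr1.
- rewrite iterSr (_ : second_diff _ = fun=> 0) ?iter_second_diff0 //.
  apply/funext => y; rewrite second_diffE /bessel_even /node_prod !big_ord0.
  by rewrite muln0 fact0 divr1 mulr2n opprD addrA subrr sub0r addNr.
- by rewrite /bessel_even /= node_prod_half // mul0r.
- by rewrite iterSr second_diff_bessel_even IH eqSS.
Qed.

Lemma iter_second_diff_bessel_odd i q x : x ^+ 2 = 2^-1 ^+ 2 ->
  iter i (@second_diff F F) (@bessel_odd F q) x = (i == q)%:R * x.
Proof.
move=> x2; elim: q i => [|q IH] [|i].
- by rewrite /bessel_odd /= node_prod_half // muln0 divr1 mulr1 mul1r.
- rewrite iterSr (_ : second_diff _ = fun=> 0) ?iter_second_diff0 ?mul0r //.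
  apply/funext => y; rewrite second_diffE /bessel_odd /node_prod !big_ord0.
  by rewrite muln0 !divr1 !mulr1 mulr2n; ring.
- by rewrite /bessel_odd /= node_prod_half // mulr0 !mul0r.
- by rewrite iterSr second_diff_bessel_odd IH eqSS.
Qed.

(** This is the step from $G_i$ to $G_{i+1}$, solved for $x^2 G_i$. It absorbs even powers into the
    Bessel basis one factor $x^2$ at a time. *)
Lemma mul_sqr_bessel_even i x :
  x ^+ 2 * bessel_even i x
  = bessel_even i.+1 x * ((2 * i + 2) * (2 * i + 1))%:R
    + bessel_even i x * (i%:R + 2^-1) ^+ 2.
Proof.
rewrite /bessel_even node_prodS mulnS !factS !natrM addn2 addn1.
rewrite -!natr1 natrM.
by field; rewrite -natrM !natr1 !pnatr_eq0 -lt0n fact_gt0.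
Qed.

Lemma mul_sqr_bessel_odd i x :
  x ^+ 2 * bessel_odd i x
  = bessel_odd i.+1 x * ((2 * i + 3) * (2 * i + 2))%:R
    + bessel_odd i x * (i%:R + 2^-1) ^+ 2.
Proof.
rewrite /bessel_odd node_prodS mulnS -addnA !addn1 !factS !natrM addn3 addn2.
rewrite -!natr1 natrM.
by field; rewrite -natrM !natr1 !pnatr_eq0 -lt0n fact_gt0.
Qed.

End BesselBasisTheory.

(** * The error functionals *)

(** Serves the tabulated coefficients: factorials become products of small numerals that [field] can
    evaluate. *)
Lemma natr_fact (F : numFieldType) n : n`!%:R = \prod_(j < n) j.+1%:R :> F.
Proof.
by elim: n => [|n IH]; rewrite ?big_ord0 // big_ord_recr /= -IH mulrC -natrM.
Qed.

(** Both parities fit one formula because $2e_i(N/2) = N G_i(N/2)/(2i+1)!$ and $e_i'(0) =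
    G_i(0)/(2i+1)!$. *)
Definition bessel_coef (F : numFieldType) (p m : nat) : F :=
  (if odd m then (2 * p + 1)%:R else 1)
  * (node_prod m./2 ((2 * p + 1)%:R / 2) - node_prod m./2 0) / m`!%:R.

Lemma bessel_coef_even (F : numFieldType) p i :
  bessel_coef F p (2 * i)
  = bessel_even i ((2 * p + 1)%:R / 2) - bessel_even i 0.
Proof.
by rewrite /bessel_coef mul2n odd_double doubleK mul1r -mul2n mulrBl.
Qed.

Lemma bessel_coef_odd (F : numFieldType) p i :
  bessel_coef F p (2 * i + 1)
  = bessel_odd i ((2 * p + 1)%:R / 2) *+ 2
    - (node_prod i 0 / (2 * i + 1)`!%:R) * (2 * p + 1)%:R.
Proof.
rewrite /bessel_coef /bessel_odd {1 2 3}addn1 /= mul2n odd_double uphalf_double.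
by rewrite -mul2n /= mulr2n; field.
Qed.

Section MidpointErrors.
Variables (F : numFieldType) (p : nat).
Let N : F := (2 * p + 1)%:R.

Section Functionals.
Variable V : lmodType F.
Implicit Types (f g : F -> V) (d e w : V).

(** The variable is the distance from the midpoint in units of $k$. The term $i=0$ has coefficient
    0; keeping it spares a separate case for $f_0$. *)
Definition value_error f : V :=
  f 0 - 2^-1 *: (f (N / 2) + f (- (N / 2)))
  + \sum_(i < p.+1) bessel_coef F p (2 * i) *:
      (2^-1 *: (iter i (@second_diff F V) f 2^-1
                + iter i (@second_diff F V) f (- 2^-1))).

(** The derivative at 0 enters as an independent vector [d], which makes the functional purely
    algebraic and linear in the pair of [f] and [d]. *)
Definition slope_error f d : V :=
  N *: d - (f (N / 2) - f (- (N / 2)))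
  + \sum_(i < p.+1) bessel_coef F p (2 * i + 1) *:
      (iter i (@second_diff F V) f 2^-1 - iter i (@second_diff F V) f (- 2^-1)).

Lemma value_errorD f g :
  value_error (fun x => f x + g x) = value_error f + value_error g.
Proof.
rewrite /value_error [RHS]addrACA -big_split /=; congr (_ + _).
  by rewrite [RHS]addrACA -opprD -scalerDr (addrACA (f _)).
apply: eq_bigr => i _; rewrite iter_second_diffD -!scalerDr.
by rewrite (addrACA (iter i _ f _)).
Qed.

Lemma slope_errorD f g d e :
  slope_error (fun x => f x + g x) (d + e) = slope_error f d + slope_error g e.
Proof.
rewrite /slope_error [RHS]addrACA -big_split /=; congr (_ + _).
  rewrite [RHS]addrACA -opprD -scalerDr; congr (_ - _).
  by rewrite opprD addrACA.
apply: eq_bigr => i _; rewrite iter_second_diffD -!scalerDr.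
by rewrite opprD (addrACA (iter i _ f _)).
Qed.

(** Every term other than $f(0)$ averages values at opposite points, and $f(0) = -f(0)$ forces $f(0)
    = 0$. *)
Lemma value_error_odd f : (forall x, f (- x) = - f x) -> value_error f = 0.
Proof.
move=> f_odd; rewrite /value_error f_odd subrr scaler0 subr0 big1 => [|i _].
  rewrite addr0; have /eqP := f_odd 0.
  rewrite oppr0 -subr_eq0 opprK -mulr2n -scaler_nat scaler_eq0 pnatr_eq0 /=.
  by move/eqP.
by rewrite iter_second_diff_odd // subrr !scaler0.
Qed.

Lemma slope_error_even f : (forall x, f (- x) = f x) -> slope_error f 0 = 0.
Proof.
move=> f_even; rewrite /slope_error f_even subrr scaler0 subr0 add0r.
by apply: big1 => i _; rewrite iter_second_diff_even // subrr scaler0.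
Qed.

End Functionals.

Lemma value_errorZ (V : lmodType F) (f : F -> F^o) (w : V) :
  value_error (fun x => f x *: w) = value_error f *: w.
Proof.
rewrite /value_error scalerDl scaler_suml; congr (_ + _).
  by rewrite scalerBl -scalerA scalerDl.
by apply: eq_bigr => i _; rewrite iter_second_diffZ -!scalerDl !scalerA.
Qed.

Lemma slope_errorZ (V : lmodType F) (f : F -> F^o) (d : F^o) (w : V) :
  slope_error (fun x => f x *: w) (d *: w) = slope_error f d *: w.
Proof.
rewrite /slope_error scalerDl scaler_suml; congr (_ + _).
  by rewrite -scalerBl scalerA -scalerBl.
by apply: eq_bigr => i _; rewrite iter_second_diffZ -!scalerBl !scalerA.
Qed.

(** Carries the vanishing on scalar monomials over to Taylor polynomials with vector
    coefficients. *)
Lemma value_error_sum (V : lmodType F) m (f : nat -> F -> F^o) (w : nat -> V) :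
  value_error (fun x => \sum_(l < m) f l x *: w l)
  = \sum_(l < m) value_error (f l) *: w l.
Proof.
elim: m => [|m IH].
  rewrite big_ord0; under [X in value_error X]eq_fun do rewrite big_ord0.
  by rewrite value_error_odd // => x; rewrite oppr0.
rewrite big_ord_recr /= -IH -value_errorZ -value_errorD; congr value_error.
by apply/funext => x; rewrite big_ord_recr.
Qed.

Lemma slope_error_sum (V : lmodType F) m (f : nat -> F -> F^o) (d : nat -> F^o)
    (w : nat -> V) :
  slope_error (fun x => \sum_(l < m) f l x *: w l) (\sum_(l < m) d l *: w l)
  = \sum_(l < m) slope_error (f l) (d l) *: w l.
Proof.
elim: m => [|m IH].
  rewrite !big_ord0; under [X in slope_error X]eq_fun do rewrite big_ord0.
  by rewrite slope_error_even.
rewrite !big_ord_recr /= -IH -slope_errorZ -slope_errorD; congr slope_error.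
by apply/funext => x; rewrite big_ord_recr.
Qed.

(** Only the term $i=q$ of the sum survives, and its coefficient $f_q(N/2)-f_q(0)$ cancels the
    leading part. *)
Lemma value_error_bessel q : (q <= p)%N ->
  value_error (bessel_even q : F -> F^o) = 0.
Proof.
move=> qp; rewrite /value_error (bigD1 (Ordinal (qp : q < p.+1)%N)) //=.
rewrite big1 => [|i iq].
  rewrite !iter_second_diff_bessel_even ?sqrrN // eqxx bessel_coef_even.
  rewrite {3}/bessel_even node_prodN -/(bessel_even _ _) -/N /GRing.scale /=.
  by field.
rewrite !iter_second_diff_bessel_even ?sqrrN //.
by rewrite (negbTE (iq : val i != q)) addr0 !scaler0.
Qed.

(** The second argument is $e_q'(0)$; again only the term $i=q$ survives and cancels the leading
    part. *)
Lemma slope_error_bessel q : (q <= p)%N ->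
  slope_error (bessel_odd q : F -> F^o) (node_prod q 0 / (2 * q + 1)`!%:R) = 0.
Proof.
move=> qp; rewrite /slope_error (bigD1 (Ordinal (qp : q < p.+1)%N)) //=.
rewrite big1 => [|i iq].
  rewrite !iter_second_diff_bessel_odd ?sqrrN // eqxx bessel_coef_odd.
  rewrite {2}/bessel_odd node_prodN !mulNr -/(bessel_odd _ _) -/N.
  rewrite /GRing.scale /=.
  by field.
rewrite !iter_second_diff_bessel_odd ?sqrrN //.
by rewrite (negbTE (iq : val i != q)) !mul0r subr0 scaler0.
Qed.

(** Induction on $q$ for all $i$: the recurrence for $x^2 f_i$ trades a factor $x^2$ for the indices
    $i+1$ and $i$, so $q+i$ does not grow. *)
Lemma value_error_expr_bessel q i : (q + i <= p)%N ->
  value_error (fun x => x ^+ (2 * q) * bessel_even i x : F^o) = 0.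
Proof.
elim: q i => [|q IH] i qi.
  rewrite -(value_error_bessel qi); congr value_error.
  by apply/funext => x; rewrite mul1r.
transitivity (value_error (fun x =>
    (x ^+ (2 * q) * bessel_even i.+1 x : F^o)
      *: (((2 * i + 2) * (2 * i + 1))%:R : F^o)
    + (x ^+ (2 * q) * bessel_even i x : F^o) *: ((i%:R + 2^-1) ^+ 2 : F^o))).
  congr value_error; apply/funext => x.
  rewrite mulnS addnC exprD -mulrA mul_sqr_bessel_even mulrDr.
  by congr (_ + _); apply: mulrA.
rewrite value_errorD !value_errorZ.
by rewrite !IH ?scale0r ?addr0 //; lia.
Qed.

(** The second argument is the derivative of $x^{2q} e_i$ at 0, because $e_i(0)=0$. *)
Lemma slope_error_expr_bessel q i : (q + i <= p)%N ->
  slope_error (fun x => x ^+ (2 * q) * bessel_odd i x : F^o)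
    (0 ^+ (2 * q) * (node_prod i 0 / (2 * i + 1)`!%:R)) = 0.
Proof.
elim: q i => [|q IH] i qi.
  have := slope_error_bessel qi; congr (_ = _); congr slope_error.
    by apply/funext => x; rewrite mul1r.
  by rewrite mul1r.
(* The recurrence for $x^2 e_i$, multiplied by $x^{2q}$ and differentiated at 0. *)
have -> : 0 ^+ (2 * q.+1) * (node_prod i 0 / (2 * i + 1)`!%:R) =
    0 ^+ (2 * q) * (node_prod i.+1 0 / (2 * i.+1 + 1)`!%:R)
      * ((2 * i + 3) * (2 * i + 2))%:R
    + 0 ^+ (2 * q) * (node_prod i 0 / (2 * i + 1)`!%:R)
      * (i%:R + 2^-1) ^+ 2 :> F.
  rewrite mulnS add2n !exprS !mul0r -!mulrA -mulrDr node_prodS mulnS -addnA.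
  rewrite !addn1 !factS !natrM addn3 addn2 -!natr1 natrM.
  by field; rewrite -natrM !natr1 !pnatr_eq0 -lt0n fact_gt0.
transitivity (slope_error (fun x =>
    (x ^+ (2 * q) * bessel_odd i.+1 x : F^o)
      *: (((2 * i + 3) * (2 * i + 2))%:R : F^o)
    + (x ^+ (2 * q) * bessel_odd i x : F^o) *: ((i%:R + 2^-1) ^+ 2 : F^o))
    ((0 ^+ (2 * q) * (node_prod i.+1 0 / (2 * i.+1 + 1)`!%:R) : F^o)
       *: (((2 * i + 3) * (2 * i + 2))%:R : F^o)
     + (0 ^+ (2 * q) * (node_prod i 0 / (2 * i + 1)`!%:R) : F^o)
       *: ((i%:R + 2^-1) ^+ 2 : F^o))).
  congr slope_error; apply/funext => x.
  rewrite mulnS addnC exprD -mulrA mul_sqr_bessel_odd mulrDr.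
  by congr (_ + _); apply: mulrA.
rewrite slope_errorD !slope_errorZ.
by rewrite !IH ?scale0r ?addr0 //; lia.
Qed.

(** Even powers are the case $f_0 = 1$ of the previous reduction; odd ones vanish by symmetry, which
    adds the degree $2p+1$. *)
Lemma value_error_expr l : (l < 2 * p + 2)%N ->
  value_error (fun x => x ^+ l : F^o) = 0.
Proof.
move=> lp; have [l_odd|l_even] := boolP (odd l).
  by apply: value_error_odd => x; rewrite exprNn -signr_odd l_odd mulN1r.
have lE : l = (2 * l./2)%N by rewrite mul2n even_halfK.
have le_p : (l./2 + 0 <= p)%N by lia.
rewrite lE -[RHS](value_error_expr_bessel le_p); congr value_error.
apply/funext => x.
by rewrite /bessel_even /node_prod big_ord0 divr1 mulr1.
Qed.

(** The parities swap roles: symmetry now disposes of the even powers, up to degree $2p+2$. *)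
Lemma slope_error_expr l : (l < 2 * p + 3)%N ->
  slope_error (fun x => x ^+ l : F^o) (l == 1)%:R = 0.
Proof.
move=> lp; have [l_odd|l_even] := boolP (odd l); last first.
  have -> : (l == 1) = false by case: eqP l_even => // ->.
  by apply: slope_error_even => x;
    rewrite exprNn -signr_odd (negbTE l_even) mul1r.
have lE : l = (2 * l./2 + 1)%N.
  by rewrite mul2n addn1 odd_halfK // prednK // odd_gt0.
have le_p : (l./2 + 0 <= p)%N by lia.
rewrite lE; have := slope_error_expr_bessel le_p.
congr (_ = _); congr slope_error.
  apply/funext => x.
  by rewrite /bessel_odd /node_prod big_ord0 divr1 mulr1 exprD.
by rewrite /node_prod big_ord0 divr1 mulr1 addn1 eqSS expr0n.
Qed.

End MidpointErrors.

(** * Taylor's formula for one-sided derivatives in a normed space *)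

Section MeanValue.
Variables (R : realType) (X : normedModType R).
Implicit Types (a b x y : R) (f : R -> X).

(* The supremum of the s where |f s - f x| <= K (s - x) is again such an s, and
   it is y since otherwise the estimate extends to its right. *)
Lemma locally_lipschitz_le a b f (K : R) : 0 <= K ->
  (forall t, t \in `[a, b] -> exists2 d : R, 0 < d &
     forall s, s \in `[a, b] -> `|s - t| < d -> `|f s - f t| <= K * `|s - t|) ->
  forall x y, x \in `[a, b] -> y \in `[a, b] -> x <= y ->
  `|f y - f x| <= K * (y - x).
Proof.
move=> K0 lip x y xab yab xy.
have in_ab s : x <= s <= y -> s \in `[a, b].
  move=> /andP[xs sy]; move: xab yab.
  rewrite !in_itv /= => /andP[ax _] /andP[_ yb].
  by rewrite (le_trans ax) ?(le_trans sy).
pose S := [set s | x <= s <= y /\ `|f s - f x| <= K * (s - x)].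
have Sx : S x by split; rewrite ?lexx ?xy // !subrr normr0 mulr0.
have supS : has_sup S by split; [exists x | exists y; move=> s [/andP[_ ->]]].
pose t := sup S.
have xt : x <= t by exact: sup_upper_bound Sx.
have ty : t <= y by apply: ge_sup; [exists x | move=> s [/andP[_ ->]]].
have [|d d0 lip_t] := lip t; first by rewrite in_ab ?xt.
have [s [/andP[xs sy] fs] ts] := sup_adherent d0 supS.
have st : s <= t by apply: sup_upper_bound => //; split; rewrite ?xs.
have ft : `|f t - f x| <= K * (t - x).
  have -> : f t - f x = (f t - f s) + (f s - f x) by rewrite addrA subrK.
  have -> : t - x = (t - s) + (s - x) by rewrite addrA subrK.
  rewrite (le_trans (ler_normD _ _)) // mulrDr lerD // distrC.
  have /lip_t : s \in `[a, b] by rewrite in_ab ?xs.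
  rewrite (ler0_norm (_ : s - t <= 0)) ?subr_le0 // opprB; apply.
  by rewrite ltrBlDr -ltrBlDl.
have [yt|yt] := leP y t; first by rewrite (_ : y = t) //; apply/le_anti/andP.
pose r := Num.min y (t + d / 2).
have tr : t < r by rewrite lt_min yt ltrDl divr_gt0.
have rd : r <= t + d / 2 by rewrite ge_min lexx orbT.
have ry : r <= y by rewrite ge_min lexx.
have xr : x <= r by rewrite (le_trans xt) ?ltW.
suff /(sup_upper_bound supS) : S r by rewrite leNgt tr.
split; first by rewrite xr.
have -> : f r - f x = (f r - f t) + (f t - f x) by rewrite addrA subrK.
have -> : r - x = (r - t) + (t - x) by rewrite addrA subrK.
rewrite (le_trans (ler_normD _ _)) // mulrDr lerD //.
have /lip_t : r \in `[a, b] by rewrite in_ab ?xr.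
have rt0 : 0 <= r - t by rewrite subr_ge0 ltW.
rewrite (ger0_norm rt0); apply.
by rewrite ltrBlDl (le_lt_trans rd) // ltrD2l ltr_pdivrMr // ltr_pMr // ltr1n.
Qed.

Lemma within_deriv_locally_lipschitz (A : set R) f x (l : X) (K : R) :
  diff_quot f x @ within A x^' --> l -> `|l| < K ->
  exists2 d : R, 0 < d &
    forall s, A s -> `|s - x| < d -> `|f s - f x| <= K * `|s - x|.
Proof.
move=> fl lK.
have : \forall s \near within A x^', `|diff_quot f x s| < K.
  by move/cvgr_norm_lt : fl; apply.
move=> /nbhs_ballP[d /= d0 Hd]; exists d => // s As sx.
have [->|sNx] := eqVneq s x; first by rewrite !subrr !normr0 mulr0.
have := Hd s; rewrite /= -ball_normE /= distrC => /(_ sx sNx As) /ltW.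
rewrite /diff_quot normrZ normfV ler_pdivrMl ?normr_gt0 ?subr_eq0 //.
by rewrite mulrC.
Qed.

(** For vector values no intermediate point need realise the increment. Instead, every constant
    above $K$ is a local Lipschitz bound, these bounds globalise, and the excess tends to 0. *)
Lemma within_deriv_mean_value a b f (g : R -> X) (K : R) :
  (forall t, t \in `[a, b] -> diff_quot f t @ within `[a, b] t^' --> g t) ->
  (forall t, t \in `[a, b] -> `|g t| <= K) ->
  forall x y, x \in `[a, b] -> y \in `[a, b] -> `|f y - f x| <= K * `|y - x|.
Proof.
move=> fg gK x y xab yab.
have K0 : 0 <= K by apply: le_trans (gK x xab).
wlog xy : x y xab yab / x <= y.
  move=> wlg; have [/wlg|/ltW/wlg] := leP x y; first exact.
  by rewrite distrC (distrC y); apply.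
rewrite (ger0_norm (_ : 0 <= y - x)) ?subr_ge0 //.
apply/ler_addgt0Pr => e e0.
(* The added 1 keeps the denominator positive when $x=y$; over $[x,y]$ the excess slope contributes
   at most [e]. *)
have e'0 : 0 < e / (y - x + 1) by rewrite divr_gt0 // ltr_wpDl // subr_ge0.
have /le_trans : `|f y - f x| <= (K + e / (y - x + 1)) * (y - x).
  apply: (@locally_lipschitz_le a b) => //; first by rewrite addr_ge0 // ltW.
  move=> t tab; have [|d d0 Hd] := within_deriv_locally_lipschitz (fg t tab)
    (_ : _ < K + e / (y - x + 1)).
    by rewrite (le_lt_trans (gK t tab)) // ltrDl.
  by exists d => // s sab; apply: Hd.
apply; rewrite mulrDl lerD2l mulrAC ler_pdivrMr ?ler_pM2l //.
  by rewrite lerDl.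
by rewrite ltr_wpDl // subr_ge0.
Qed.

End MeanValue.

Lemma diff_quot_shift (R : realType) (X : normedModType R) (f : R -> X) x :
  diff_quot f x @ x^' = (fun h => h^-1 *: (f (h + x) - f x)) @ 0^'.
Proof.
rewrite funeqE => P.
change ((\forall y \near x, y != x -> P (diff_quot f x y)) =
  (\forall h \near 0, h != 0 -> P (h^-1 *: (f (h + x) - f x)))).
rewrite (near_shift 0) subr0; congr (nbhs _ _); apply/funext => h.
by rewrite /diff_quot /shift /= -subr_eq0 addrK.
Qed.

Section Taylor.
Variables (R : realType) (X : normedModType R).

(** The scalar factor is a polynomial, so its formal derivative gives the two-sided limit, which
    restricts to [A]. *)
Lemma cvg_diff_quot_monomial (A : set R) (c x : R) n (w : X) :
  diff_quot (fun y => ((y - c) ^+ n.+1 / (n.+1)`!%:R) *: w) x @ within A x^'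
    --> ((x - c) ^+ n / n`!%:R) *: w.
Proof.
pose p : {poly R} := (n.+1)`!%:R^-1 *: ('X - c%:P) ^+ n.+1.
have pE y : p.[y] = (y - c) ^+ n.+1 / (n.+1)`!%:R.
  by rewrite /p !hornerE mulrC.
have [] := is_derive_poly p x.
have -> : p^`().[x] = (x - c) ^+ n / n`!%:R.
  rewrite /p derivZ deriv_exp derivXsubC mul1r /= hornerZ hornerMn !hornerE.
  rewrite factS natrM -mulr_natl -natr1; field.
  by rewrite natr1 !pnatr_eq0 -lt0n fact_gt0.
rewrite -derive1E => p_cvg p_lim.
have gx : (fun y => (y - x)^-1 * (p.[y] - p.[x])) @ x^'
    --> (x - c) ^+ n / n`!%:R.
  rewrite [X in X --> _](@diff_quot_shift R R^o (horner p)).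
  move: p_cvg; rewrite /derivable.
  under [X in cvg (X @ _)]eq_fun do rewrite [_%:A]mulr1.
  by move=> p_cvg; rewrite -p_lim.

rewrite (_ : diff_quot _ _ = fun y => ((y - x)^-1 * (p.[y] - p.[x])) *: w).
  by apply: cvgZr_tmp; apply: cvg_within_filter.
by apply/funext => y; rewrite /diff_quot -scalerBl scalerA !pE.
Qed.

Lemma cvg_diff_quotB (A : set R) (f g : R -> X) x (l m : X) :
  diff_quot f x @ within A x^' --> l -> diff_quot g x @ within A x^' --> m ->
  diff_quot (fun y => f y - g y) x @ within A x^' --> l - m.
Proof.
move=> fl gm.
rewrite (_ : diff_quot _ x = fun y => diff_quot f x y - diff_quot g x y).
  exact: cvgB.
apply/funext => y; rewrite /diff_quot -scalerBr; congr (_ *: _).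
by rewrite opprD addrACA -opprD.
Qed.

Lemma cvg_diff_quotD (A : set R) (f g : R -> X) x (l m : X) :
  diff_quot f x @ within A x^' --> l -> diff_quot g x @ within A x^' --> m ->
  diff_quot (fun y => f y + g y) x @ within A x^' --> l + m.
Proof.
move=> fl gm.
rewrite (_ : diff_quot _ x = fun y => diff_quot f x y + diff_quot g x y).
  exact: cvgD.
by apply/funext => y; rewrite /diff_quot -scalerDr opprD addrACA.
Qed.

Lemma cvg_diff_quot_cst (A : set R) (w : X) x :
  diff_quot (fun=> w) x @ within A x^' --> (0 : X).
Proof.
rewrite (_ : diff_quot _ _ = fun=> 0); first exact: cvg_cst.
by apply/funext => y; rewrite /diff_quot subrr scaler0.
Qed.

(** Induction on [m]: the remainder differentiates to the remainder of the shifted sequence, and the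
    mean value bound costs one factor [r]. A general sequence [D] makes this shift possible; the
    bound without a factorial already has the right order. *)
Lemma taylor_within a b (c r M : R) m (D : nat -> R -> X) :
  c \in `[a, b] ->
  (forall x, x \in `[a, b] -> `|x - c| <= r) ->
  (forall j x, (j < m)%N -> x \in `[a, b] ->
     diff_quot (D j) x @ within `[a, b] x^' --> D j.+1 x) ->
  (forall x, x \in `[a, b] -> `|D m x| <= M) ->
  forall x, x \in `[a, b] ->
  `|D 0 x - \sum_(l < m) ((x - c) ^+ l / l`!%:R) *: D l c| <= M * r ^+ m.
Proof.
move=> cab cr; elim: m D => [|m IH] D dD DM x xab.
  by rewrite big_ord0 subr0 mulr1 DM.
have r0 : 0 <= r by apply: le_trans (cr _ cab).
have M0 : 0 <= M by apply: le_trans (DM _ cab).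
pose T m' (E : nat -> X) y : X := \sum_(l < m') ((y - c) ^+ l / l`!%:R) *: E l.
have dT m' E y : diff_quot (T m'.+1 E) y @ within `[a, b] y^' -->
    T m' (fun l => E l.+1) y.
  elim: m' => [|m' IHm].
    rewrite (_ : T 1 E = fun=> E 0).
      by rewrite /T big_ord0; apply: cvg_diff_quot_cst.
    by apply/funext => z; rewrite /T big_ord1 expr0 fact0 divr1 scale1r.
  rewrite (_ : T _ E = fun z => T m'.+1 E z
      + ((z - c) ^+ m'.+1 / m'.+1`!%:R) *: E m'.+1); last first.
    by apply/funext => z; rewrite /T big_ord_recr.
  rewrite /T big_ord_recr; apply: cvg_diff_quotD => //.
  exact: cvg_diff_quot_monomial.
(* The remainder vanishes at [c], so a bound on its increment from [c] bounds the remainder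
   itself. *)
have Tc : T m.+1 (D^~ c) c = D 0 c.
  rewrite /T big_ord_recl big1 ?addr0 => [|l _].
    by rewrite expr0 fact0 divr1 scale1r.
  by rewrite subrr expr0n /= mul0r scale0r.
have := @within_deriv_mean_value _ _ a b (fun y => D 0 y - T m.+1 (D^~ c) y)
  (fun y => D 1 y - T m (fun l => D l.+1 c) y) (M * r ^+ m) _ _ c x cab xab.
rewrite Tc subrr subr0 => /(_ _ _)/le_trans; apply.
- by move=> t tab; apply: cvg_diff_quotB; [apply: dD | apply: dT].
- by move=> t tab; apply: (IH (fun l => D l.+1)) => // j y jm; apply: dD.
- by rewrite exprSr mulrA ler_wpM2l ?mulr_ge0 ?exprn_ge0 // cr.
Qed.

End Taylor.

(** * Error bounds *)

Lemma bessel_coef_low (F : numFieldType) p m :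
  m./2 = 0 -> bessel_coef F p m = 0.
Proof.
by move=> m0; rewrite /bessel_coef m0 /node_prod !big_ord0 subrr mulr0 mul0r.
Qed.

Section ErrorBounds.
Variables (R : realType) (X : normedModType R) (p : nat).
Let N : R := (2 * p + 1)%:R.

(** The [i] second differences read [f] within distance [i] of [x], and the absolute weights of each
    one add up to $1+2+1=4$. *)
Lemma iter_second_diff_le i (f : R -> X) (B x : R) :
  (forall y, `|y - x| <= i%:R -> `|f y| <= B) ->
  `|iter i (@second_diff R X) f x| <= 4 ^+ i * B.
Proof.
elim: i x => [|i IH] x fB /=.
  by rewrite expr0 mul1r fB // subrr normr0.
have IH' y : `|y - x| <= 1 -> `|iter i (@second_diff R X) f y| <= 4 ^+ i * B.
  move=> yx; apply: IH => z zy; apply: fB.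
  have -> : z - x = (z - y) + (y - x) by rewrite addrA subrK.
  by rewrite -natr1 (le_trans (ler_normD _ _)) // lerD.
have := IH' x; rewrite subrr normr0 => /(_ ler01) H0.
have := IH' (x + 1); rewrite addrAC subrr add0r normr1 => /(_ (lexx _)) H1.
have := IH' (x - 1).
rewrite addrAC subrr add0r normrN normr1 => /(_ (lexx _)) H2.
rewrite second_diffE (le_trans (ler_normD _ _)) //.
rewrite (le_trans (lerD (ler_normB _ _) (lexx _))) // normrMn.
by rewrite exprS; lra.
Qed.

(** Around $\pm 1/2$ a stencil of radius $i \le p$ stays within $p+1/2 = N/2$ of 0. *)
Lemma iter_second_diff_half_le i (f : R -> X) (B x : R) :
  (forall s, `|s| <= N / 2 -> `|f s| <= B) -> (i <= p)%N -> `|x| = 2^-1 ->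
  `|iter i (@second_diff R X) f x| <= 4 ^+ i * B.
Proof.
move=> fB ip x2; apply: iter_second_diff_le => y yx; apply: fB.
rewrite -(subrK x y) (le_trans (ler_normD _ _)) // x2.
have : i%:R <= p%:R :> R by rewrite ler_nat.
by rewrite /N natrD natrM; lra.
Qed.

(** The leading 2 accounts for $f(0)$ and the mean of the end values; each average of second
    differences contributes $4^i$. *)
Definition value_const : R :=
  2 + \sum_(i < p.+1) `|bessel_coef R p (2 * i)| * 4 ^+ i.

Definition slope_const : R :=
  2 + \sum_(i < p.+1) `|bessel_coef R p (2 * i + 1)| * (4 ^+ i * 2).

Lemma value_error_le (f : R -> X) (B : R) :
  (forall s, `|s| <= N / 2 -> `|f s| <= B) ->
  `|value_error p f| <= value_const * B.
Proof.
move=> fB; rewrite /value_error mulrDl (le_trans (ler_normD _ _)) // lerD //.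
  have N0 : 0 <= N / 2 by rewrite divr_ge0.
  have := fB 0; rewrite normr0 => /(_ N0) f0.
  have := fB (N / 2); rewrite ger0_norm // => /(_ (lexx _)) f1.
  have := fB (- (N / 2)); rewrite normrN ger0_norm // => /(_ (lexx _)) f2.
  rewrite (le_trans (ler_normB _ _)) // normrZ ger0_norm ?invr_ge0 //.
  have := ler_normD (f (N / 2)) (f (- (N / 2))).
  by rewrite -/N; lra.
rewrite mulr_suml (le_trans (ler_norm_sum _ _ _)) //; apply: ler_sum => i _.
rewrite normrZ -mulrA ler_wpM2l // normrZ ger0_norm ?invr_ge0 //.
have ip : (i <= p)%N by rewrite -ltnS.
have h2 : `|2^-1 : R| = 2^-1 by rewrite ger0_norm ?invr_ge0.
have := iter_second_diff_half_le fB ip h2.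
have := iter_second_diff_half_le fB ip (etrans (normrN _) h2).
have := ler_normD (iter i (@second_diff R X) f 2^-1)
  (iter i (@second_diff R X) f (- 2^-1)).
by lra.
Qed.

Lemma slope_error_le (f : R -> X) (B : R) :
  (forall s, `|s| <= N / 2 -> `|f s| <= B) ->
  `|slope_error p f 0| <= slope_const * B.
Proof.
move=> fB; rewrite /slope_error mulrDl (le_trans (ler_normD _ _)) // lerD //.
  have N0 : 0 <= N / 2 by rewrite divr_ge0.
  have := fB (N / 2); rewrite ger0_norm // => /(_ (lexx _)) f1.
  have := fB (- (N / 2)); rewrite normrN ger0_norm // => /(_ (lexx _)) f2.
  rewrite scaler0 sub0r normrN.
  have := ler_normB (f (N / 2)) (f (- (N / 2))).
  by rewrite -/N; lra.
rewrite mulr_suml (le_trans (ler_norm_sum _ _ _)) //; apply: ler_sum => i _.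
rewrite normrZ -mulrA ler_wpM2l //.
have ip : (i <= p)%N by rewrite -ltnS.
have h2 : `|2^-1 : R| = 2^-1 by rewrite ger0_norm ?invr_ge0.
have := iter_second_diff_half_le fB ip h2.
have := iter_second_diff_half_le fB ip (etrans (normrN _) h2).
have := ler_normB (iter i (@second_diff R X) f 2^-1)
  (iter i (@second_diff R X) f (- 2^-1)).
by lra.
Qed.

(** By linearity the polynomial part contributes nothing, and only the uniformly small remainder is
    left to estimate. *)
Lemma value_error_poly_approx m (f : R -> X) (w : nat -> X) (B : R) :
  (m <= 2 * p + 2)%N ->
  (forall s, `|s| <= N / 2 -> `|f s - \sum_(l < m) s ^+ l *: w l| <= B) ->
  `|value_error p f| <= value_const * B.
Proof.
move=> mp fB.
rewrite (_ : f = fun s => (\sum_(l < m) s ^+ l *: w l)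
    + (f s - \sum_(l < m) s ^+ l *: w l)); last first.
  by apply/funext => s; rewrite addrC subrK.
rewrite value_errorD (value_error_sum p m (fun l (s : R) => s ^+ l : R^o)).
rewrite big1 ?add0r => [|l _]; first exact: value_error_le.
by rewrite value_error_expr ?scale0r // (leq_trans (ltn_ord l)).
Qed.

Lemma slope_error_poly_approx m (f : R -> X) (w : nat -> X) (B : R) :
  (1 < m <= 2 * p + 3)%N ->
  (forall s, `|s| <= N / 2 -> `|f s - \sum_(l < m) s ^+ l *: w l| <= B) ->
  `|slope_error p f (w 1)| <= slope_const * B.
Proof.
move=> /andP[m1 mp] fB.
rewrite (_ : f = fun s => (\sum_(l < m) s ^+ l *: w l)
    + (f s - \sum_(l < m) s ^+ l *: w l)); last first.
  by apply/funext => s; rewrite addrC subrK.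
(* The vector [w 1] is the derivative at 0 of the polynomial part, which leaves derivative 0 for the
   remainder. *)
rewrite -[w 1]addr0.
have -> : w 1 = \sum_(l < m) ((l == 1 :> nat)%:R : R^o) *: w l.
  rewrite (bigD1 (Ordinal m1)) //= scale1r big1 ?addr0 // => l l1.
  by rewrite (negbTE (l1 : val l != 1)) scale0r.
rewrite slope_errorD (slope_error_sum p m (fun l (s : R) => s ^+ l : R^o)
  (fun l => (l == 1)%:R)).
rewrite big1 ?add0r => [|l _]; first exact: slope_error_le.
by rewrite slope_error_expr ?scale0r // (leq_trans (ltn_ord l)).
Qed.

End ErrorBounds.

(** * Grid operators as rescaled second differences *)

Section Grid.
Variables (R : realType) (X : normedModType R).
Implicit Types (v : int -> X) (k : R).

Lemma DplusDminusE k i v :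
  DplusDminus k i v = fun n => k ^- (2 * i) *: iter i (@second_diff int X) v n.
Proof.
elim: i => [|i IH].
  by apply/funext => n; rewrite muln0 expr0 invr1 scale1r.
apply/funext => n; rewrite /DplusDminus iterS -/(DplusDminus k i v) IH.
rewrite /= /Dplus /Dminus addrK -!scalerBr !scalerA second_diffE.
rewrite mulnS exprD invfM expr2 invfM; congr (_ *: _).
  by rewrite mulrA.
by rewrite opprB addrA mulr2n opprD addrA addrAC.
Qed.

Lemma expr_Dhalf k i v n : k != 0 ->
  k ^+ (2 * i + 1) *: Dhalf k (DplusDminus k i v) n
  = iter i (@second_diff int X) v (n + 1) - iter i (@second_diff int X) v n.
Proof.
move=> k0; rewrite DplusDminusE /Dhalf -scalerBr !scalerA -[RHS]scale1r.
by congr (_ *: _); rewrite addn1 exprSr mulfK // divff // expf_neq0.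
Qed.

Lemma expr_Ehalf k i v n : k != 0 ->
  k ^+ (2 * i) *: Ehalf (DplusDminus k i v) n
  = 2^-1 *: (iter i (@second_diff int X) v (n + 1)
             + iter i (@second_diff int X) v n).
Proof.
move=> k0; rewrite DplusDminusE /Ehalf -scalerDr !scalerA mulrAC.
by rewrite divff ?mul1r // expf_neq0.
Qed.

(** A unit step of the index is a unit step of the rescaled variable, so sampling commutes with
    second differences. *)
Lemma iter_second_diff_grid i (f : R -> X) (c : R) :
  iter i (@second_diff int X) (fun n => f (n%:~R - c))
  = (fun n => iter i (@second_diff R X) f (n%:~R - c)).
Proof.
elim: i => //= i ->; apply/funext => n.
by rewrite !second_diffE !intrD mulrN1z (addrAC n%:~R 1) (addrAC n%:~R (-1)).
Qed.

End Grid.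

(** * Rescaling of $[a,b]$ and Taylor estimate at the midpoint *)

Section Midpoint.
Variables (R : realType) (X : normedModType R) (p : nat) (a b : R).
Variable u : R -> X.
Hypothesis ab : a < b.
Let N : R := (2 * p + 1)%:R.
Let k : R := (b - a) / N.
Let mid : R := (a + b) / 2.
Let v : int -> X := grid a k u.
Let phi (s : R) : X := u (mid + s * k).

Let N_gt0 : 0 < N. Proof. by rewrite ltr0n addn1. Qed.

Let k_gt0 : 0 < k. Proof. by rewrite divr_gt0 // subr_gt0. Qed.

Let v_phi : v = fun n => phi (n%:~R - N / 2).
Proof.
apply/funext => n; rewrite /v /grid /phi /mid; congr u.
by rewrite /k; field; rewrite lt0r_neq0.
Qed.

Let phi_Nhalf : phi (N / 2) = u b.
Proof. by rewrite /phi /mid /k; congr u; field; rewrite lt0r_neq0. Qed.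

Let phi_NNhalf : phi (- (N / 2)) = u a.
Proof. by rewrite /phi /mid /k; congr u; field; rewrite lt0r_neq0. Qed.

Let phi_0 : phi 0 = u mid. Proof. by rewrite /phi mul0r addr0. Qed.

(** Since $N/2 = p+1/2$, the indices $p$ and $p+1$ are the two nodes next to the midpoint. *)
Let half_nodes : (p%:Z%:~R - N / 2 = - 2^-1) * ((p%:Z + 1)%:~R - N / 2 = 2^-1).
Proof.
by split; rewrite ?intrD -?pmulrn /N natrD natrM ?rmorph1; field.
Qed.

Lemma value_errorE :
  value_error p phi = u mid - (2^-1 *: (u b + u a)
    - \sum_(1 <= i < p.+1) (bessel_coef R p (2 * i) * k ^+ (2 * i))
        *: Ehalf (DplusDminus k i v) p%:Z).
Proof.
rewrite /value_error phi_Nhalf phi_NNhalf phi_0 opprB addrA [RHS]addrAC.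
congr (_ + _).
rewrite big_add1 /= big_mkord big_ord_recl bessel_coef_low // scale0r add0r.
apply: eq_bigr => i _; rewrite -scalerA expr_Ehalf ?lt0r_neq0 // v_phi.
by rewrite iter_second_diff_grid !half_nodes.
Qed.

(** If [d] is $u'$ at the midpoint, then [k *: d] is the derivative of [phi] at 0. The factor $b-a =
    Nk$ clears the denominators of the formula. *)
Lemma slope_errorE (d : X) :
  slope_error p phi (k *: d) = (b - a) *: (d - ((b - a)^-1 *: (u b - u a)
    - (b - a)^-1 *:
      \sum_(1 <= i < p.+1) (bessel_coef R p (2 * i + 1) * k ^+ (2 * i + 1))
        *: Dhalf k (DplusDminus k i v) p%:Z)).
Proof.
have ba0 : b - a != 0 by rewrite lt0r_neq0 // subr_gt0.
rewrite -(scalerBr (b - a)^-1) (scalerBr (b - a)) [in X in _ - X]scalerA.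
rewrite divff // scale1r opprB.
rewrite /slope_error phi_Nhalf phi_NNhalf scalerA mulrC divfK ?lt0r_neq0 //.
rewrite [RHS]addrA [RHS]addrAC; congr (_ + _).
rewrite big_add1 /= big_mkord big_ord_recl bessel_coef_low // scale0r add0r.
apply: eq_bigr => i _; rewrite -scalerA expr_Dhalf ?lt0r_neq0 // v_phi.
by rewrite iter_second_diff_grid !half_nodes.
Qed.

(** Near an interior point the constraint $y \in [a,b]$ holds automatically, so the limit along
    $[a,b]$ is the ordinary one. *)
Lemma derive1_within x : a < x < b -> derivable_within `[a, b] u x ->
  (u^`())%classic x = derive_within `[a, b] u x.
Proof.
move=> /andP[ax xb] du; apply/cvg_lim => //.
rewrite -diff_quot_shift; apply: cvg_trans du; apply: cvg_app.
move=> P xP.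
have xab : \forall y \near x, y \in `]a, b[.
  by apply: near_in_itvoo; rewrite in_itv /= ax.
apply: filterS2 xab xP => y yab yP yx; apply: yP => //.
exact: subset_itv_oo_cc.
Qed.

(** Taylor's bound with radius $(b-a)/2 = (N/2)k$; this radius is the source of the power of $k$. *)
Lemma midpoint_taylor (M : R) (q m : nat) : (m <= q)%N -> Cm_on q a b u ->
  (forall j x, (j <= q)%N -> x \in `[a, b] ->
     `|derive_within_n `[a, b] j u x| <= M) ->
  forall s : R, `|s| <= N / 2 ->
  `|phi s - \sum_(l < m) s ^+ l *:
       ((k ^+ l / l`!%:R) *: derive_within_n `[a, b] l u mid)|
  <= M * (N / 2) ^+ m * k ^+ m.
Proof.
move=> mq [du _] uM s sN.
have kN : N / 2 * k = (b - a) / 2 by rewrite /k; field; rewrite lt0r_neq0.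
have itvE x : (x \in `[a, b]) = (`|x - mid| <= (b - a) / 2).
  by rewrite in_itv /= ler_distl /mid; congr (_ && _); apply/idP/idP; lra.
have ab0 : 0 <= (b - a) / 2 by rewrite divr_ge0 // subr_ge0 ltW.
have := @taylor_within R X a b mid ((b - a) / 2) M m
  (fun j => derive_within_n `[a, b] j u).
rewrite itvE subrr normr0 => /(_ ab0) /(_ _ _ _ (mid + s * k)).
rewrite -mulrA -exprMn kN.
have -> : \sum_(l < m) s ^+ l *:
      ((k ^+ l / l`!%:R) *: derive_within_n `[a, b] l u mid)
  = \sum_(l < m) ((mid + s * k - mid) ^+ l / l`!%:R)
      *: derive_within_n `[a, b] l u mid.
  apply: eq_bigr => l _; rewrite scalerA mulrA -exprMn.
  congr ((_ ^+ _ / _) *: _).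
  by rewrite addrAC subrr add0r.
apply.
- by move=> x; rewrite itvE.
- by move=> j x jm xab; apply: du => //; apply: leq_trans mq.
- by move=> x; apply: uM.
- by rewrite itvE addrAC subrr add0r normrM (gtr0_norm k_gt0) -kN ler_pM2r.
Qed.

End Midpoint.

Theorem theorem6 (R : realType) :
  exists c : nat -> nat -> R,
    (forall p : nat, (0 < p)%N ->
     forall M : R, exists C : R,
     forall (X : completeNormedModType R) (a b : R) (u : R -> X),
       a < b ->
       Cm_on (2 * p + 3) a b u ->
       (forall j : nat, (j <= 2 * p + 3)%N -> forall x : R, x \in `[a, b] ->
          `|derive_within_n `[a, b] j u x| <= M) ->
       let k : R := (b - a) / (2 * p + 1)%:R in
       let mid : R := (a + b) / 2 in
       let v : int -> X := grid a k u in
       `|(u^`())%classic mid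
           - ((b - a)^-1 *: (u b - u a)
              - (b - a)^-1 *:
                \sum_(1 <= i < p.+1)
                   (c p (2 * i + 1)%N * k ^+ (2 * i + 1))
                     *: Dhalf k (DplusDminus k i v) p%:Z)|
         <= C * k ^+ (2 * p + 2)
       /\
       `|u mid
           - (2^-1 *: (u b + u a)
              - \sum_(1 <= i < p.+1)
                   (c p (2 * i)%N * k ^+ (2 * i))
                     *: Ehalf (DplusDminus k i v) p%:Z)|
         <= C * k ^+ (2 * p + 2))
    /\ (c 1%N 2%N = 9 / 8 /\ c 1%N 3%N = 9 / 8)
    /\ (c 2%N 2%N = 25 / 8 /\ c 2%N 3%N = 125 / 24 /\
        c 2%N 4%N = 125 / 128 /\ c 2%N 5%N = 125 / 128)
    /\ (c 3%N 2%N = 49 / 8 /\ c 3%N 3%N = 343 / 24 /\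
        c 3%N 4%N = 637 / 128 /\ c 3%N 5%N = (13 * 1000 + 377) / 1920 /\
        c 3%N 6%N = 1029 / 1024 /\ c 3%N 7%N = 1029 / 1024)
    /\ (c 4%N 2%N = 81 / 8 /\ c 4%N 3%N = 243 / 8 /\
        c 4%N 4%N = 1917 / 128 /\ c 4%N 5%N = (17 * 1000 + 253) / 640 /\
        c 4%N 6%N = (7 * 1000 + 173) / 1024 /\
        c 4%N 7%N = (64 * 1000 + 557) / (7 * 1000 + 168) /\
        c 4%N 8%N = (32 * 1000 + 733) / (32 * 1000 + 768) /\
        c 4%N 9%N = (32 * 1000 + 733) / (32 * 1000 + 768)).

Proof.
exists (bessel_coef R); split=> [p p_gt0 M|]; last first.
  (* The tabulated values follow by expanding the finite products. *)
  by do ![split]; rewrite /bessel_coef natr_fact /node_prod /=;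
    rewrite !(big_ord_recr, big_ord0) /=; field.
pose N : R := (2 * p + 1)%:R.
(* Each constant combines the norm bound of a functional with Taylor's bound, of order $2p+3$ for
   the slope and $2p+2$ for the value. Dividing the slope estimate by $b-a = Nk$ costs one power of
   $k$ and gives the factor $1/N$. Using [|M|] makes the constants nonnegative for every [M]. *)
pose Cs := slope_const R p * (`|M| * (N / 2) ^+ (2 * p + 3)) / N.
pose Cv := value_const R p * (`|M| * (N / 2) ^+ (2 * p + 2)).
have N_gt0 : 0 < N by rewrite ltr0n addn1.
have Cs_ge0 : 0 <= Cs.
  rewrite !mulr_ge0 ?invr_ge0 ?exprn_ge0 ?divr_ge0 ?(ltW N_gt0) //.
  by rewrite addr_ge0 // sumr_ge0 // => i _; rewrite !mulr_ge0 ?exprn_ge0.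
have Cv_ge0 : 0 <= Cv.
  rewrite !mulr_ge0 ?exprn_ge0 ?divr_ge0 ?(ltW N_gt0) //.
  by rewrite addr_ge0 // sumr_ge0 // => i _; rewrite mulr_ge0 ?exprn_ge0.
(* Both constants are nonnegative, so their sum serves both estimates. *)
exists (Cs + Cv) => X a b u ab Cu uM k mid v.
have ba_gt0 : 0 < b - a by rewrite subr_gt0.
have k_gt0 : 0 < k by rewrite divr_gt0.
have kN : b - a = N * k by rewrite mulrC divfK ?lt0r_neq0.
have mid_ab : a < mid < b by rewrite !midf_lt.
have mid_in : mid \in `[a, b] by rewrite in_itv /= !ltW //; case/andP: mid_ab.
have uM' j x : (j <= 2 * p + 3)%N -> x \in `[a, b] ->
    `|derive_within_n `[a, b] j u x| <= `|M|.
  by move=> jp xab; rewrite (le_trans (uM j jp x xab)) ?ler_norm.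
pose w l : X := (k ^+ l / l`!%:R) *: derive_within_n `[a, b] l u mid.
have taylor m (mp : (m <= 2 * p + 3)%N)
  := midpoint_taylor (p := p) ab mp Cu uM'.
split.
  rewrite (derive1_within mid_ab); last first.
    by have [du _] := Cu; apply: (du 0) => //; rewrite addn3.
  set E := (X in `|X|).
  have : `|(b - a) *: E| <= Cs * N * k ^+ (2 * p + 3).
    rewrite -(slope_errorE p u ab) divfK ?lt0r_neq0 // -mulrA.
    have m_gt1 : (1 < 2 * p + 3 <= 2 * p + 3)%N by rewrite leqnn addn3.
    have := slope_error_poly_approx (w := w) m_gt1 (taylor _ (leqnn _)).
    by rewrite /w expr1 divr1 mulrA.
  have -> : Cs * N * k ^+ (2 * p + 3) = (b - a) * (Cs * k ^+ (2 * p + 2)).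
    by rewrite kN addnS exprS; ring.
  rewrite normrZ gtr0_norm // ler_pM2l // => /le_trans; apply.
  by rewrite ler_wpM2r ?exprn_ge0 ?(ltW k_gt0) // lerDl.
rewrite -(value_errorE p u ab).
have mp : (2 * p + 2 <= 2 * p + 3)%N by rewrite leq_add2l.
apply: le_trans (value_error_poly_approx (w := w) (leqnn _) (taylor _ mp)) _.
by rewrite mulrA ler_wpM2r ?exprn_ge0 ?(ltW k_gt0) // lerDr.
Qed.
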